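(* For every integer $a\ge1$, the golden sieve on $W_0=a\mathbb{N}+1$ produces, in normalized indices, the $\mathcal{P}$-positions of Fraenkel's game $\mathrm{NIM}(a,1)$: $A_n=\sigma_n$ and $B_n=\delta_n$ for all $n\ge1$, where $(A_n,B_n)$ are the Fraenkel $\mathcal{P}$-position pairs and $(\sigma_n)$, $(\delta_n)$ are the normalized survivor and deletion sequences.
   Context: $\mathbb{N}=\{1,2,3,\ldots\}$ and $a\mathbb{N}+1=\{an+1:n\ge1\}$, viewed as an increasing sequence. For a strictly increasing sequence $X$ of positive integers, $X(k)$ denotes its $k$-th term. Golden sieve: let $W_0=(w_1<w_2<\cdots)$ be an infinite strictly increasing sequence of positive integers. For $n\ge1$ define inductively $h_n:=W_{n-1}(n)$ (the pointer), $d_n:=W_{n-1}(h_n)$ (the deletion), and let $W_n$ be the increasing sequence obtained from $W_{n-1}$ by removing the value $d_n$. The survivor sequence $(s_n)_{n\ge1}$ is the increasing enumeration of $W_0\setminus\{d_1,d_2,\ldots\}$. For $W_0=a\mathbb{N}+1$ the normalized sequences are $\sigma_n:=(s_n-1)/a$ and $\delta_n:=(d_n-1)/a$. Fraenkel pairs: the $\mathcal{P}$-position pairs $(A_n,B_n)_{n\ge1}$ of $\mathrm{NIM}(a,1)$ are given by the unique pair of increasing sequences of positive integers $(A_n)_{n\ge1}$, $(B_n)_{n\ge1}$ that partition $\mathbb{N}$ and satisfy $B_n=aA_n+n$ for all $n\ge1$; equivalently, $A_n=\min\bigl(\mathbb{N}\setminus\{A_1,\ldots,A_{n-1},B_1,\ldots,B_{n-1}\}\bigr)$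 and $B_n=aA_n+n$. *)

(* Defs.v *)
From mathcomp Require Import all_boot all_order all_algebra zify.

Set Implicit Arguments.
Unset Strict Implicit.
Unset Printing Implicit Defensive.

Import GRing.Theory.

(* A sequence X(1), X(2), ... is a function nat -> nat; its value at index 0 is
   never used. *)

Definition increasing (X : nat -> nat) : Prop :=
  forall i j : nat, 0 < i -> i < j -> X i < X j.

Definition is_term (X : nat -> nat) (v : nat) : Prop :=
  exists2 k : nat, 0 < k & X k = v.

Definition increasing_enum (S : nat -> Prop) (X : nat -> nat) : Prop :=
  increasing X /\ forall v : nat, is_term X v <-> S v.

Lemma increasing_enum_uniq S X Y :
  increasing_enum S X -> increasing_enum S Y ->
  forall n, 0 < n -> X n = Y n.
Proof.
move=> [incX SX] [incY SY]; elim/ltn_ind=> n IH n_gt0.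
have gen (U V : nat -> nat) : increasing U -> increasing V ->
    (forall v, is_term V v <-> S v) -> (forall v, is_term U v <-> S v) ->
    (forall k, k < n -> 0 < k -> U k = V k) -> U n < V n -> False.
  move=> incU incV SV SU eqUV ltUV.
  have /SU/SV[k k_gt0 Vk] : is_term U (U n) by exists n.
  have [ltkn|ltnk|eqkn] := ltngtP k n.
  - by have := incU _ _ k_gt0 ltkn; rewrite eqUV // Vk ltnn.
  - by have := incV _ _ n_gt0 ltnk; lia.
  - by move: Vk; rewrite eqkn; lia.
have [lt|gt|//] := ltngtP (X n) (Y n).
- by case: (gen X Y).
- by case: (gen Y X) => // k ltkn k_gt0; rewrite IH.
Qed.

(* For X increasing and v a term of X, this is the increasing sequence of the
   terms of X other than v: the terms above v move down by one index. *)
Definition remove (v : nat) (X : nat -> nat) : nat -> nat :=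
  fun k => if X k < v then X k else X k.+1.

Lemma remove_enum v X :
  increasing X -> is_term X v ->
  increasing_enum (fun w => is_term X w /\ w <> v) (remove v X).
Proof.
move=> incX [i i_gt0 Xi].
have removeE k : 0 < k -> remove v X k = X (if k < i then k else k.+1).
  move=> k_gt0; rewrite /remove -Xi; have [ltki|ltik|->] := ltngtP k i.
  - by rewrite incX.
  - by have /ltnW := incX _ _ i_gt0 ltik; rewrite leqNgt => /negbTE->.
  - by rewrite ltnn.
split=> [j k j_gt0 ltjk|w].
  have k_gt0 : 0 < k := ltn_trans j_gt0 ltjk.
  rewrite !removeE //.
  by apply: incX; [case: ifP | case: (ltnP j i); case: (ltnP k i); lia].
split=> [[k k_gt0]|[[k k_gt0 <-] neq]].
  rewrite removeE // => <-; split; first by exists (if k < i then k else k.+1); case: ifP.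
  rewrite -Xi; case: (ltnP k i) => [ltki|leik].
  - by have := incX _ _ k_gt0 ltki; lia.
  - by have := incX i k.+1 i_gt0 leik; lia.
have [ltki|ltik|eqki] := ltngtP k i.
- by exists k; rewrite ?removeE // ltki.
- exists k.-1; first by lia.
  rewrite removeE; last by lia.
  by case: ifP => lt; congr X; lia.
- by case: neq; rewrite eqki.
Qed.

Fixpoint sieve (W0 : nat -> nat) (n : nat) : nat -> nat :=
  if n is m.+1 then
    let W := sieve W0 m in remove (W (W m.+1)) W
  else W0.

Definition pointer (W0 : nat -> nat) (n : nat) : nat := sieve W0 n.-1 n.

Definition deletion (W0 : nat -> nat) (n : nat) : nat :=
  sieve W0 n.-1 (pointer W0 n).

Lemma sieveS W0 n :
  sieve W0 n.+1 = remove (deletion W0 n.+1) (sieve W0 n).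
Proof. by []. Qed.

Definition survives (W0 : nat -> nat) (v : nat) : Prop :=
  is_term W0 v /\ ~ is_term (deletion W0) v.

Definition progression (a : nat) : nat -> nat := fun n => a * n + 1.

Definition normalize (a w : nat) : rat := ((w%:R - 1) / a%:R)%R.

Record fraenkel_pairs (a : nat) (A B : nat -> nat) : Prop := FraenkelPairs {
  fraenkel_incA : increasing A;
  fraenkel_incB : increasing B;
  fraenkel_posA : forall n, 0 < n -> 0 < A n;
  fraenkel_posB : forall n, 0 < n -> 0 < B n;
  fraenkel_cover : forall v, 0 < v -> is_term A v \/ is_term B v;
  fraenkel_disjoint : forall v, ~ (is_term A v /\ is_term B v);
  fraenkel_eq : forall n, 0 < n -> B n = a * A n + n
}.

Lemma fraenkel_pairs_uniq a A B A' B' :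
  0 < a -> fraenkel_pairs a A B -> fraenkel_pairs a A' B' ->
  forall n, 0 < n -> A n = A' n /\ B n = B' n.
Proof.
move=> a_gt0 FP FP'.
suff eqA n : 0 < n -> A n = A' n.
  by move=> n n_gt0; rewrite (fraenkel_eq FP) ?(fraenkel_eq FP') ?eqA.
have gen U V U' V' m : fraenkel_pairs a U V -> fraenkel_pairs a U' V' ->
    (forall k, k < m -> 0 < k -> U k = U' k) -> 0 < m -> U m < U' m -> False.
  move=> F F' IH m_gt0 lt.
  have [[k k_gt0 eqk]|[k k_gt0 eqk]] := fraenkel_cover F' (fraenkel_posA F m_gt0).
  - have [ltkm|ltmk|eqkm] := ltngtP k m.
    + by have := fraenkel_incA F k_gt0 ltkm; rewrite IH // eqk ltnn.
    + by have := fraenkel_incA F' m_gt0 ltmk; lia.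
    + by move: eqk; rewrite eqkm; lia.
  - have ltkm : k < m.
      rewrite ltnNge; apply/negP=> lemk.
      have leU : U' m <= U' k.
        have [->//|ltmk] := eqVneq m k.
        by apply/ltnW/(fraenkel_incA F'); rewrite // ltn_neqAle ltmk.
      by have := fraenkel_eq F' k_gt0; nia.
    apply: (fraenkel_disjoint F (v := U m)); split; first by exists m.
    by exists k => //; rewrite -eqk (fraenkel_eq F) // (fraenkel_eq F') // IH.
elim/ltn_ind: n => n IH n_gt0.
have [lt|gt|//] := ltngtP (A n) (A' n).
- by case: (gen _ _ _ _ _ FP FP' IH n_gt0 lt).
- by case: (gen _ _ _ _ _ FP' FP _ n_gt0 gt) => k ltkn k_gt0; rewrite IH.
Qed.

Definition mex (l : seq nat) : nat :=
  (find (fun v => v \notin l) (iota 1 (size l).+1)).+1.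

Lemma mexP l : mex l \notin l /\ forall v, 0 < v -> v < mex l -> v \in l.
Proof.
set p := fun v => v \notin l; set s := iota 1 (size l).+1.
have hs : has p s.
  apply/negPn/negP=> /hasPn sl.
  have /uniq_leq_size : {subset s <= l} by move=> v /sl; rewrite negbK.
  by rewrite size_iota ltnn => /(_ (iota_uniq _ _)).
have lt_f : find p s < (size l).+1 by rewrite -(size_iota 1 (size l).+1) -has_find.
split; first by have := nth_find 0 hs; rewrite nth_iota.
case=> // v _; rewrite /mex ltnS => ltv.
have := before_find 0 ltv; rewrite nth_iota ?add1n; last exact: ltn_trans lt_f.
by move/negbFE.
Qed.

(* The values A_1, B_1, ..., A_n, B_n of the mex recursion. *)
Fixpoint mex_values (a n : nat) : seq nat :=
  if n is m.+1 then
    let l := mex_values a m in [:: mex l, a * mex l + n & l]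
  else [::].

Definition mexA (a n : nat) : nat := mex (mex_values a n.-1).
Definition mexB (a n : nat) : nat := a * mexA a n + n.

Lemma fraenkel_pairs_mex a : 0 < a -> fraenkel_pairs a (mexA a) (mexB a).
Proof.
move=> a_gt0.
have valsS n : mex_values a n.+1 = [:: mexA a n.+1, mexB a n.+1 & mex_values a n].
  by [].
have vals_mono i j v : i <= j -> v \in mex_values a i -> v \in mex_values a j.
  elim: j => [|j IH]; first by rewrite leqn0 => /eqP->.
  rewrite leq_eqVlt => /orP[/eqP->//|]; rewrite ltnS => /IH IHj /IHj vj.
  by rewrite valsS !inE vj !orbT.
have mem_vals i j : 0 < i -> i <= j ->
    (mexA a i \in mex_values a j) /\ (mexB a i \in mex_values a j).
  case: i => // i _ leij; split; apply: (vals_mono _ _ _ leij);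
  by rewrite valsS !inE eqxx ?orbT.
have valsP n v : v \in mex_values a n ->
    is_term (mexA a) v \/ is_term (mexB a) v.
  elim: n => // n IH; rewrite valsS !inE => /or3P[/eqP->|/eqP->|//].
  - by left; exists n.+1.
  - by right; exists n.+1.
have posA n : 0 < mexA a n by [].
have incA : increasing (mexA a).
  move=> i j i_gt0 ltij; have le1 : i <= j.-1 by lia.
  have [nj _] := mexP (mex_values a j.-1).
  have [_ minI] := mexP (mex_values a i.-1).
  have [memA _] := mem_vals _ _ i_gt0 le1.
  rewrite ltn_neqAle; apply/andP; split.
    by apply/eqP=> eqA; move: nj; rewrite -/(mexA a j) -eqA memA.
  rewrite leqNgt; apply/negP=> /(minI _ (posA j)) memj.
  by move/negP: nj; apply; apply: vals_mono memj; lia.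
have geA n : n <= mexA a n.
  elim: n => // -[|n] IH; first exact: posA.
  by apply: leq_ltn_trans IH _; apply: incA.
split=> //.
- by move=> i j i_gt0 ltij; have := incA _ _ i_gt0 ltij; rewrite /mexB; nia.
- by move=> n n_gt0; rewrite /mexB addn_gt0 n_gt0 orbT.
- move=> v v_gt0; apply: (valsP v).
  by have [_] := mexP (mex_values a v); apply=> //; apply: (geA v.+1).
- move=> v [[i i_gt0 eqA] [j j_gt0 eqB]].
  have [ltji|leij] := ltnP j i.
    have [ni _] := mexP (mex_values a i.-1); move/negP: ni; apply.
    rewrite -/(mexA a i) eqA -eqB.
    by have [|_] := mem_vals j i.-1 j_gt0; first by lia.
  have leA : mexA a i <= mexA a j.
    have [->//|neij] := eqVneq i j.
    by apply/ltnW/incA; rewrite // ltn_neqAle neij.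
  by move: eqB; rewrite /mexB -eqA; nia.
Qed.

(* Main.v *)
Require Import Defs.
From mathcomp Require Import all_boot all_order all_algebra.
From mathcomp Require Import zify.

Set Implicit Arguments.
Unset Strict Implicit.
Unset Printing Implicit Defensive.

(* After n steps the sieve has removed exactly the values a B_i + 1 for i <= n.
   Every B_j with j > n exceeds A_(n+1), so the indices up to A_(n+1) that are
   left are A_1, ..., A_(n+1) and the pointer is a A_(n+1) + 1.  This pointer,
   used as a position, lies beyond all n gaps, so the term found there has index
   (a A_(n+1) + 1) + n = B_(n+1). *)

Lemma increasing_leq X i j : increasing X -> 0 < i -> i <= j -> X i <= X j.
Proof.
move=> incX i_gt0; rewrite leq_eqVlt => /predU1P[->//|ltij].
exact/ltnW/incX.
Qed.

Lemma increasing_ltn X i j :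
  increasing X -> 0 < i -> 0 < j -> (X i < X j) = (i < j).
Proof.
move=> incX i_gt0 j_gt0; case: (ltnP i j) => [|leji]; first exact: incX.
by apply/negbTE; rewrite -leqNgt increasing_leq.
Qed.

(** By strong induction: the smaller of [X k] and [Y k] lies in [S], so it occurs in the other
    sequence at some index [j < k], where both sequences agree, and one of them would repeat a
    value. Matching [S] only up to [Y m] suffices to read off the pointer. *)
Lemma increasing_enum_prefix S X Y m :
  increasing_enum S X -> increasing Y ->
  (forall k, 0 < k -> k <= m -> S (Y k)) ->
  (forall v, S v -> v <= Y m -> exists2 k, 0 < k <= m & Y k = v) ->
  forall k, 0 < k -> k <= m -> X k = Y k.
Proof.
move=> [incX XS] incY SY initY; elim/ltn_ind=> k IH k_gt0 lekm.
have [ltXY|ltYX|//] := ltngtP (X k) (Y k).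
- have SXk : S (X k) by apply/XS; exists k.
  have [|j /andP[j_gt0 lejm] Yj] := initY _ SXk.
    exact: leq_trans (ltnW ltXY) (increasing_leq incY k_gt0 lekm).
  have ltjk : j < k by rewrite -(increasing_ltn incY) // Yj.
  by have := incX _ _ j_gt0 ltjk; rewrite IH // Yj ltnn.
- have /XS[j j_gt0 Xj] := SY _ k_gt0 lekm.
  have ltjk : j < k by rewrite -(increasing_ltn incX) // Xj.
  have := incY _ _ j_gt0 ltjk; rewrite -Xj IH ?ltnn //.
  exact: leq_trans (ltnW ltjk) lekm.
Qed.

(** The candidate for the set of terms of [sieve (progression a) n]. *)
Definition unsieved (a : nat) (B : nat -> nat) (n v : nat) : Prop :=
  exists2 u, 0 < u & v = a * u + 1 /\ forall i, 0 < i -> i <= n -> u <> B i.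

Lemma unsieved_pointer a A B n X :
  0 < a -> fraenkel_pairs a A B -> increasing_enum (unsieved a B n) X ->
  X n.+1 = a * A n.+1 + 1.
Proof.
move=> a_gt0 F enumX.
apply: (increasing_enum_prefix (Y := fun k => a * A k + 1) (m := n.+1) enumX) => //.
- by move=> i j i_gt0 /(fraenkel_incA F i_gt0); nia.
- move=> k k_gt0 _; exists (A k); first exact: (fraenkel_posA F).
  split=> // i i_gt0 _ eqAB; apply: (fraenkel_disjoint F (v := A k)).
  by split; [exists k | exists i].
- move=> _ [u u_gt0 [-> notB]] leu; have {}leu : u <= A n.+1 by nia.
  have [[k k_gt0 Ak]|[k k_gt0 Bk]] := fraenkel_cover F u_gt0.
    exists k; last by rewrite Ak.
    rewrite k_gt0 leqNgt -(increasing_ltn (fraenkel_incA F)) //.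
    by rewrite Ak -leqNgt.
  have [lekn|ltnk] := leqP k n; first by case: (notB k).
  (* For [k > n], [B k = a * A k + k > A k >= A n.+1 >= u] contradicts [B k = u]. *)
  have := increasing_leq (fraenkel_incA F) (ltn0Sn n) ltnk.
  by have := fraenkel_eq F k_gt0; nia.
Qed.

(** Both halves go through one induction: the set of terms determines the pointer, and the formula
    for the tail evaluates the sieve there. The hypothesis of that formula says that all [n] removed
    indices lie below [k + n], so position [k] has been shifted by exactly [n]. *)
Lemma sieve_fraenkel a A B :
  0 < a -> fraenkel_pairs a A B -> forall n,
  increasing_enum (unsieved a B n) (sieve (progression a) n) /\
  forall k, 0 < k -> (forall i, 0 < i -> i <= n -> B i < k + n) ->
    sieve (progression a) n k = a * (k + n) + 1.
Proof.
move=> a_gt0 F; elim=> [|n [enumW tailW]].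
  split=> [|k _ _]; last by rewrite addn0.
  split=> [i j _ ltij|v]; first by rewrite /= /progression ltn_add2r ltn_pmul2l.
  split=> [[k k_gt0 <-]|[u u_gt0 [-> _]]]; last by exists u.
  by exists k => //; split=> // -[].
have incB := fraenkel_incB F.
pose d := a * B n.+1 + 1; pose W := sieve (progression a) n.
have Wd : W (a * A n.+1 + 1) = d.
  (* The position plus [n] is [B n.+1], so the side condition of [tailW] becomes [B i < B n.+1]. *)
  rewrite /W tailW; first by rewrite /d (fraenkel_eq F) //; congr (a * _ + 1); lia.
    by rewrite addn1.
  by move=> i i_gt0 /(incB _ n.+1 i_gt0); rewrite (fraenkel_eq F (n := n.+1)) //; lia.
have -> : sieve (progression a) n.+1 = remove d W.
  by rewrite /= (unsieved_pointer a_gt0 F enumW) -/W Wd.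
have [incW termW] := enumW; rewrite -/W in incW termW tailW.
have termd : is_term W d by exists (a * A n.+1 + 1); first by rewrite addn1.
have [incR termR] := remove_enum incW termd.
split; first split=> // v.
- rewrite termR termW; split=> [[[u u_gt0 [-> notB] neqd]]|].
    exists u => //; split=> // i i_gt0; rewrite leq_eqVlt ltnS.
    by case/predU1P=> [->|/(notB i i_gt0)//] equ; apply: neqd; rewrite equ.
  move=> [u u_gt0 [-> notB]]; split.
    by exists u => //; split=> // i i_gt0 lein; apply: notB; rewrite ?leqW.
  by have := notB n.+1 isT (leqnn _); rewrite /d; nia.
- move=> k k_gt0 ltB; have := ltB n.+1 isT (leqnn _).
  rewrite (fraenkel_eq F) // => ltAk.
  (* [ltAk] puts [k] at or beyond the position of [d], so [remove] reads [W k.+1]; this adds one to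
     the shift. *)
  rewrite /remove ltnNge -Wd (increasing_leq incW) //=; [|by lia|by lia].
  rewrite tailW ?addSnnS // => i i_gt0 lein.
  by apply: ltB; rewrite ?leqW.
Qed.

Lemma deletion_fraenkel a A B n :
  0 < a -> fraenkel_pairs a A B -> 0 < n ->
  deletion (progression a) n = a * B n + 1.
Proof.
move=> a_gt0 F; case: n => // n _.
have [enumW tailW] := sieve_fraenkel a_gt0 F n.
rewrite /deletion /pointer /= (unsieved_pointer a_gt0 F enumW) tailW.
- by rewrite (fraenkel_eq F) //; congr (a * _ + 1); lia.
- by rewrite addn1.
- move=> i i_gt0 /(fraenkel_incB F i_gt0 (j := n.+1)).
  by rewrite (fraenkel_eq F (n := n.+1)) //; lia.
Qed.

(** The deletions are exactly the terms with index in [B], and [A] and [B] are complementary, so the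
    indices in [A] remain. *)
Lemma survives_fraenkel a A B :
  0 < a -> fraenkel_pairs a A B ->
  increasing_enum (survives (progression a)) (fun n => a * A n + 1).
Proof.
move=> a_gt0 F; split=> [i j i_gt0 /(fraenkel_incA F i_gt0)|v]; first by nia.
split=> [[n n_gt0 <-]|[[u u_gt0 <-] undel]].
  split; first by exists (A n); first exact: (fraenkel_posA F).
  case=> k k_gt0; rewrite (deletion_fraenkel a_gt0 F) // => eqBA.
  apply: (fraenkel_disjoint F (v := A n)).
  by split; [exists n | exists k => //; nia].
have [[k k_gt0 Ak]|[k k_gt0 Bk]] := fraenkel_cover F u_gt0.
  by exists k; rewrite ?Ak.
by case: undel; exists k; rewrite ?(deletion_fraenkel a_gt0 F) ?Bk.
Qed.

Lemma normalizeK a u : 0 < a -> (u%:R = normalize a (a * u + 1))%R.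
Proof.
move=> a_gt0; rewrite /normalize GRing.natrD GRing.addrK GRing.natrM GRing.mulrC.
by rewrite GRing.mulKf // Num.Theory.pnatr_eq0 -lt0n.
Qed.

Theorem proposition4p3 (a : nat) (ha : 1 <= a) (A B : nat -> nat)
    (hAB : fraenkel_pairs a A B) :
  exists s : nat -> nat,
    increasing_enum (survives (progression a)) s /\
    forall n : nat, 1 <= n ->
      ((A n)%:R = normalize a (s n) /\
       (B n)%:R = normalize a (deletion (progression a) n))%R.
Proof.
exists (fun n => a * A n + 1); split; first exact: survives_fraenkel ha hAB.
move=> n n_gt0; rewrite (deletion_fraenkel ha hAB) //.
by split; apply: normalizeK.
Qed.
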